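(* There exist constants $0<\alpha<1$ and $C>0$ such that for all $n,m\in\mathbb{N}$ the following holds: if an HMM topology is selected uniformly at random from all irreducible, labeled, $n$-state, $m$-symbol edge-emitting topologies, then it is path-mergeable with probability at least $1-C\alpha^n$. The same statement holds with ''state-emitting'' in place of ''edge-emitting''.
   Context: A labeled $n$-state, $m$-symbol edge-emitting HMM topology is a directed graph on vertex set (states) $\{1,\dots,n\}$ with edges labeled by symbols in $\{1,\dots,m\}$, i.e. a subset $E\subseteq\{1,\dots,n\}\times\{1,\dots,n\}\times\{1,\dots,m\}$, where $(i,j,x)\in E$ means that the transition $i\to j$ on symbol $x$ is allowed. A labeled $n$-state, $m$-symbol state-emitting HMM topology is a directed graph (self-loops allowed) on $\{1,\dots,n\}$ giving the allowed state transitions, together with, for each state $j$, a nonempty set $O_j\subseteq\{1,\dots,m\}$ of allowed output symbols. Not all symbols need be used. Topologies differing by a relabeling of states or symbols are considered distinct. A topology is irreducible if its underlying directed graph on states is strongly connected (for all states $i,j$ there is a directed path from $i$ to $j$). For a word $w=x_1\cdots x_\ell$, $\delta_i(w)$ denotes the set of states $j$ for which there is a path $i=s_0,s_1,\dots,s_\ell=j$ of allowed transitions emitting $w$: in the edge-emitting case $(s_{t-1},s_t,x_t)\in E$ for $t=1,\dots,\ell$; in the state-emitting case $s_{t-1}\to s_t$ is an allowed transition and $x_t\in O_{s_t}$ for $t=1,\dots,\ell$. A topology is path-mergeable if for each pair of distinct states $i,j$ there exist a word $w$ and a state $k$ with $k\in\delta_i(w)\cap\delta_j(w)$. *)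

(* Defs.v *)
From HB Require Import structures.
From mathcomp Require Import all_boot all_order all_algebra.
From mathcomp Require Import boolp reals.

Set Implicit Arguments.
Unset Strict Implicit.
Unset Printing Implicit Defensive.

Import Order.TTheory GRing.Theory Num.Theory.
Local Open Scope ring_scope.

(* States {1..n} and symbols {1..m} are represented by 'I_n and 'I_m. *)

Definition edge_topology (n m : nat) : finType := {set 'I_n * 'I_n * 'I_m}.

(* T.1 is the set of allowed state transitions, T.2 j the set of allowed
   output symbols of state j. *)
Definition state_topology (n m : nat) : finType :=
  {T : {set 'I_n * 'I_n} * {ffun 'I_n -> {set 'I_m}}
     | [forall j, T.2 j != set0]}.

Definition edge_graph n m (E : edge_topology n m) : rel 'I_n :=
  fun i j => [exists x, (i, j, x) \in E].

Definition state_graph n m (T : state_topology n m) : rel 'I_n :=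
  fun i j => (i, j) \in (val T).1.

Definition irreducible n (e : rel 'I_n) : bool :=
  [forall i, forall j, connect e i j].

(* [step i x j]: moving from i to j while emitting x is allowed. *)
Definition edge_step n m (E : edge_topology n m) (i : 'I_n) (x : 'I_m)
  (j : 'I_n) : bool := (i, j, x) \in E.

Definition state_step n m (T : state_topology n m) (i : 'I_n) (x : 'I_m)
  (j : 'I_n) : bool := state_graph T i j && (x \in (val T).2 j).

Section Delta.
Variables (n m : nat) (step : 'I_n -> 'I_m -> 'I_n -> bool).

(* i :: s is a path of allowed transitions emitting w. *)
Fixpoint emits (i : 'I_n) (s : seq 'I_n) (w : seq 'I_m) : bool :=
  match s, w with
  | [::], [::] => true
  | j :: s', x :: w' => step i x j && emits j s' w'
  | _, _ => false
  end.

Definition delta (i : 'I_n) (w : seq 'I_m) : {set 'I_n} :=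
  [set j | [exists s : (size w).-tuple 'I_n, emits i s w && (last i s == j)]].

Definition path_mergeable : Prop :=
  forall i j : 'I_n, i != j ->
    exists (w : seq 'I_m) (k : 'I_n), k \in delta i w :&: delta j w.

End Delta.

(* Probability that an element drawn uniformly from A satisfies P; it is only
   meaningful when A is nonempty. *)
Definition uniform_prob (R : realType) (T : finType) (A : {set T})
  (P : T -> Prop) : R :=
  #|[set t in A | `[< P t >]]|%:R / #|A|%:R.

Definition irreducible_edge_topologies n m : {set edge_topology n m} :=
  [set E | irreducible (edge_graph E)].

Definition irreducible_state_topologies n m : {set state_topology n m} :=
  [set T | irreducible (state_graph T)].

(* Main.v *)
Require Import Defs.
From HB Require Import structures.
From mathcomp Require Import all_boot all_order all_algebra.
From mathcomp Require Import boolp reals.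
From mathcomp Require Import ring lra.

Set Implicit Arguments.
Unset Strict Implicit.
Unset Printing Implicit Defensive.

Import Order.TTheory GRing.Theory Num.Theory.
Local Open Scope ring_scope.

(** Call a digraph on the states [confluent] if any two distinct states have a
    common out-neighbour, and [two_step] if any two distinct states are joined
    by a path of length two. In a uniformly random digraph each of these
    properties fails with probability O(n^2 (3/4)^n), by a union bound over
    pairs of states. A state-emitting topology is path-mergeable as soon as its
    graph is confluent, because the symbol emitted depends only on the common
    target; an edge-emitting topology is path-mergeable, resp. irreducible, as
    soon as the digraph of its edges labelled by one fixed symbol is confluent,
    resp. two_step. In both cases the digraph in question is uniformly
    distributed when the topology is, so conditioning on irreducibility costs
    at most a factor 2 once n is large. *)

(** * Counting: equal fibres and forbidden pairs of elements *)

(* [get] and [put] form a lens: all fibres of [get] then have the same size,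
   i.e. [get] maps the uniform distribution to the uniform distribution. *)
Lemma card_lens (T G : finType) (get : T -> G) (put : G -> T -> T)
    (P : pred G) :
    (forall g t, get (put g t) = g) ->
    (forall g t, put (get t) (put g t) = t) ->
  (#|[set t | P (get t)]| * #|G| = #|T| * #|[set g | P g]|)%N.
Proof.
move=> getK putK.
pose fib g := [set t | get t == g].
(* On the fibre over [g], the map [put g'] has left inverse [put g], so it embeds this fibre into
   the one over [g']. *)
have le_fib g g' : (#|fib g| <= #|fib g'|)%N.
  have injp : {in fib g &, injective (put g')}.
    move=> t t'; rewrite !inE => /eqP <- /eqP gt' eqp.
    by rewrite -(putK g' t) eqp -gt' putK.
  rewrite -(card_in_imset injp); apply/subset_leq_card/subsetP => u.
  by case/imsetP=> t _ ->; rewrite inE getK.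
have card_P (Q : pred G) g0 :
    #|[set t | Q (get t)]| = (#|[set g | Q g]| * #|fib g0|)%N.
  rewrite -sum1_card (partition_big get Q) /=; last by move=> t; rewrite inE.
  rewrite [#|finset Q|]cardsE -sum_nat_const; apply: eq_bigr => g Qg.
  have -> : #|fib g0| = #|fib g| by apply/eqP; rewrite eqn_leq !le_fib.
  rewrite -sum1_card; apply: eq_bigl => t; rewrite !inE.
  by case: eqP => [->|]; rewrite ?Qg ?andbF.
have [g0|G0] := pickP G; last first.
  rewrite (eq_card0 (A := [set g | P g])); last by move=> g; have := G0 g.
  by rewrite (eq_card0 G0) !muln0.
move=> _; rewrite (card_P P g0) -(cardsT T).
have -> : [set: T] = [set t | xpredT (get t)] by apply/setP=> t; rewrite !inE.
rewrite (card_P xpredT g0).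
have -> : #|[set g : G | xpredT g]| = #|G| by rewrite cardsE; apply: eq_card.
by rewrite mulnC mulnA mulnAC.
Qed.

(** Overwriting [X] on the image of [h] and keeping it elsewhere is a [put] for the preimage map, so
    the preimage of a uniformly random set under an injection is uniformly random. *)
Lemma card_preimset_lens (S S' : finType) (h : S -> S')
    (P : pred {set S}) : injective h ->
  (#|[set X : {set S'} | P (h @^-1: X)]| * #|{set S}| =
   #|{set S'}| * #|[set Y | P Y]|)%N.
Proof.
move=> injh.
apply: (@card_lens {set S'} {set S} (fun X => h @^-1: X)
          (fun Y X => (h @: Y) :|: [set s in X | s \notin codom h]) P).
  move=> Y X; apply/setP=> s; rewrite !inE mem_imset //.
  by rewrite codom_f andbF orbF.
move=> Y X; apply/setP=> s; rewrite !inE.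
have [/codomP[t ->]|s_h] := boolP (s \in codom h).
  by rewrite mem_imset // !inE andbF orbF.
rewrite /=; case: imsetP => [[t _ st]|_].
  by rewrite st codom_f in s_h.
case: imsetP => [[t _ st]|_] /=; first by rewrite st codom_f in s_h.
by rewrite !andbT.
Qed.

Lemma card_set_pairs (K : finType) : #|{set K * bool}| = (4 ^ #|K|)%N.
Proof.
have := card_powerset [set: K * bool].
by rewrite powersetT !cardsT card_prod card_bool mulnC expnM.
Qed.

(** Each [k] has four membership patterns, chosen independently, of which only [(true, true)] is
    forbidden. *)
Lemma card_avoid_fibres (K : finType) :
  #|[set X : {set K * bool} |
      [forall k, ~~ (((k, true) \in X) && ((k, false) \in X))]]|
  = (3 ^ #|K|)%N.
Proof.
pose get (X : {set K * bool}) : {ffun K -> bool * bool} :=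
  [ffun k => ((k, true) \in X, (k, false) \in X)].
pose put (g : {ffun K -> bool * bool}) (X : {set K * bool}) :=
  [set p : K * bool | if p.2 then (g p.1).1 else (g p.1).2].
pose P (g : {ffun K -> bool * bool}) :=
  g \in ffun_on (predC1 (true, true)).
have getK g X : get (put g X) = g.
  by apply/ffunP=> k; rewrite ffunE !inE /=; case: (g k).
have putK g X : put (get X) (put g X) = X.
  by apply/setP=> -[k []]; rewrite !inE ffunE.
have cardP : #|[set g | P g]| = (3 ^ #|K|)%N.
  by rewrite cardsE card_ffun_on cardC1 card_prod card_bool.
have := card_lens P getK putK; rewrite cardP card_ffun.
rewrite card_set_pairs card_prod card_bool mulnC => /eqP.
rewrite eqn_pmul2l ?expn_gt0 // => /eqP <-.
apply: eq_card => X; rewrite !inE.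
apply/forallP/ffun_onP => H k; have := H k; rewrite !inE ffunE xpair_eqE;
  by case: (_ \in X); case: (_ \in X).
Qed.

(** All the points [a k] and [b k] are distinct, so the conditions for different [k] are
    independent, each of probability 3/4. The map [h] reduces this to subsets of [K * bool]. *)
Lemma card_avoid_pairs (S K : finType) (a b : K -> S) :
    injective a -> injective b -> (forall k k', a k != b k') ->
  (#|[set X : {set S} | [forall k, ~~ ((a k \in X) && (b k \in X))]]|
     * 4 ^ #|K| = #|{set S}| * 3 ^ #|K|)%N.
Proof.
move=> inja injb ab.
pose h (p : K * bool) := if p.2 then a p.1 else b p.1.
have injh : injective h.
  move=> [k []] [k' []] /= E; first by move/inja: E => /= ->.
  - by have := ab k k'; rewrite [a k]E eqxx.
  - by have := ab k' k; rewrite -[a k']E eqxx.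
  - by move/injb: E => /= ->.
have := @card_preimset_lens _ _ h
  (fun X => [forall k, ~~ (((k, true) \in X) && ((k, false) \in X))]) injh.
rewrite card_avoid_fibres card_set_pairs => <-; congr (_ * _)%N.
apply: eq_card => X; rewrite !inE.
by apply: eq_forallb => k; rewrite !inE.
Qed.

(** Union bound: after exchanging the sums, each [t] on the left is counted at least once on the
    right. *)
Lemma card_exists_le (I T : finType) (Q : I -> pred T) :
  (#|[set t | [exists i, Q i t]]| <= \sum_i #|[set t | Q i t]|)%N.
Proof.
under eq_bigr do rewrite -sum1_card.
rewrite -sum1_card (exchange_big_dep predT) //= big_mkcond /=.
apply: leq_sum => t _; rewrite inE; case: existsP => // -[i Qit].
by rewrite (bigD1 i) ?inE //= leq_addr.
Qed.

(** * Exponential tail bounds for a uniformly random digraph *)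

Section RandomDigraphs.
Variables (R : realType) (n : nat).
Implicit Types X : {set 'I_n * 'I_n}.

Definition confluent X :=
  [forall p : 'I_n * 'I_n, (p.1 != p.2) ==>
    [exists k, ((p.1, k) \in X) && ((p.2, k) \in X)]].

Definition two_step X :=
  [forall p : 'I_n * 'I_n, (p.1 != p.2) ==>
    [exists k, ((p.1, k) \in X) && ((k, p.2) \in X)]].

Lemma two_step_irreducible (e : rel 'I_n) X :
  (forall i j, (i, j) \in X -> e i j) -> two_step X -> irreducible e.
Proof.
move=> Xe /forallP tX; apply/forallP=> i; apply/forallP=> j.
have [->|ij] := eqVneq i j; first exact: connect0.
have /implyP/(_ ij)/existsP[k /andP[ik kj]] := tX (i, j).
exact: connect_trans (connect1 (Xe _ _ ik)) (connect1 (Xe _ _ kj)).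
Qed.

Let alpha : R := 363 / 400.

(* Bernoulli's inequality for 11/10, squared; alpha = (3/4) (11/10)^2. *)
Lemma sqr_three_quarters_le :
  n%:R ^+ 2 * (3 / 4) ^+ n <= 100 * alpha ^+ n :> R.
Proof.
have bern k : 1 + k%:R / 10 <= (11 / 10) ^+ k :> R.
  elim: k => [|k IH]; first by rewrite expr0; lra.
  rewrite exprS -natr1; have : 0 <= k%:R :> R by [].
  move: IH; set u := _ ^+ k; lra.
have -> : alpha ^+ n = ((11 / 10) ^+ n) ^+ 2 * (3 / 4) ^+ n :> R.
  by rewrite -exprM mulnC exprM -exprMn /alpha; congr (_ ^+ _); field.
rewrite mulrA ler_wpM2r ?exprn_ge0 //; first by lra.
have n0 : 0 <= n%:R :> R by [].
have := bern n; set u := _ ^+ n; nra.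
Qed.

Lemma card_union_pairs (Q : 'I_n * 'I_n -> pred {set 'I_n * 'I_n}) (c : R) :
    0 <= c ->
    (forall p, p.1 != p.2 ->
      #|[set X | ~~ Q p X]|%:R <= c * #|{set 'I_n * 'I_n}|%:R) ->
  #|[set X | ~~ [forall p, (p.1 != p.2) ==> Q p X]]|%:R <=
    n%:R ^+ 2 * c * #|{set 'I_n * 'I_n}|%:R.
Proof.
move=> c0 HQ.
have -> : [set X | ~~ [forall p, (p.1 != p.2) ==> Q p X]] =
          [set X | [exists p, (p.1 != p.2) && ~~ Q p X]].
  apply/setP=> X; rewrite !inE negb_forall; apply: eq_existsb => p.
  by rewrite negb_imply.
apply: le_trans (_ : (\sum_p #|[set X | (p.1 != p.2) && ~~ Q p X]|)%:R <= _).
  rewrite ler_nat.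
  exact: (card_exists_le (fun p X => (p.1 != p.2) && ~~ Q p X)).
rewrite natr_sum.
apply: le_trans (_ : \sum_(p : 'I_n * 'I_n) c * #|{set 'I_n * 'I_n}|%:R <= _).
  (* A diagonal pair contributes the empty set, so bounding by all [n ^ 2] pairs is harmless. *)
  apply: ler_sum => p _; have [_|pp] := eqVneq p.1 p.2.
    have -> : [set X | ~~ true && ~~ Q p X] = set0.
      by apply/setP=> X; rewrite !inE.
    by rewrite cards0 mulr_ge0.
  by apply: HQ.
by rewrite sumr_const card_prod card_ord -[leLHS]mulr_natl natrM expr2 !mulrA.
Qed.

Lemma card_avoid_pairs_ratio (S K : finType) (a b : K -> S) :
    injective a -> injective b -> (forall k k', a k != b k') ->
  #|[set X : {set S} | ~~ [exists k, (a k \in X) && (b k \in X)]]|%:R =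
  (3 / 4) ^+ #|K| * #|{set S}|%:R :> R.
Proof.
move=> inja injb ab.
have /(congr1 (fun k => k%:R : R)) := card_avoid_pairs inja injb ab.
have -> : [set X : {set S} | [forall k, ~~ ((a k \in X) && (b k \in X))]] =
          [set X : {set S} | ~~ [exists k, (a k \in X) && (b k \in X)]].
  by apply/setP=> X; rewrite !inE negb_exists.
rewrite !natrM !natrX expr_div_n => E.
have u4 : (4 : R) ^+ #|K| != 0 by rewrite expf_neq0 // pnatr_eq0.
by rewrite mulrAC -(mulrC _%:R) -E mulfK.
Qed.

(** For two distinct states, the edges into the [n] candidate targets are all different, so each
    target fails independently with probability 3/4. *)
Lemma card_not_confluent :
  #|[set X | ~~ confluent X]|%:R <=
    100 * alpha ^+ n * #|{set 'I_n * 'I_n}|%:R :> R.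
Proof.
apply: le_trans (_ : n%:R ^+ 2 * (3 / 4) ^+ n * #|{set 'I_n * 'I_n}|%:R <= _);
  last by rewrite ler_wpM2r ?sqr_three_quarters_le.
apply: (card_union_pairs (Q := fun p X =>
  [exists k, ((p.1, k) \in X) && ((p.2, k) \in X)])) => [|p pp].
  by rewrite exprn_ge0 //; lra.
rewrite card_avoid_pairs_ratio ?card_ord //.
- by move=> k k' [].
- by move=> k k' [].
- by move=> k k'; rewrite xpair_eqE (negPf pp).
Qed.

Lemma card_not_two_step :
  #|[set X | ~~ two_step X]|%:R <=
    200 * alpha ^+ n * #|{set 'I_n * 'I_n}|%:R :> R.
Proof.
have q0 k : 0 <= (3 / 4 : R) ^+ k by rewrite exprn_ge0 //; lra.
(* Only [n - 2] midpoints are used below, which costs the factor 16/9 = (4/3)^2; then 100 * 16/9 is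
   at most 200. *)
apply: le_trans (_ : n%:R ^+ 2 * (16 / 9 * (3 / 4) ^+ n) *
                     #|{set 'I_n * 'I_n}|%:R <= _); last first.
  rewrite ler_wpM2r //; have := sqr_three_quarters_le.
  have : 0 <= alpha ^+ n by rewrite exprn_ge0 // /alpha; lra.
  lra.
apply: (card_union_pairs (Q := fun p X =>
  [exists k, ((p.1, k) \in X) && ((k, p.2) \in X)])) => [|p pp].
  by have := q0 n; lra.
(* The midpoints [p.1] and [p.2] would share the edge [p] itself; without them all edges involved
   are distinct. *)
pose K : finType := {k : 'I_n | k \in ~: [set p.1; p.2]}.
have cardK : (#|K| + 2 = n)%N.
  by rewrite card_sig -[RHS]card_ord -(cardsC [set p.1; p.2]) cards2 pp addnC.
have -> : (16 / 9 * (3 / 4) ^+ n : R) = (3 / 4) ^+ #|K|.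
  move: #|K| cardK => k <-; rewrite exprD expr2; set u := _ ^+ k.
  by field.
have KP (k : K) : (val k != p.1) && (val k != p.2).
  by have := valP k; rewrite !inE negb_or.
rewrite -(@card_avoid_pairs_ratio _ K (fun k => (p.1, val k))
                                      (fun k => (val k, p.2))).
- rewrite ler_nat; apply/subset_leq_card/subsetP => X; rewrite !inE.
  by apply: contra => /existsP[k Xk]; apply/existsP; exists (val k).
- by move=> k k' [] /val_inj.
- by move=> k k' [] /val_inj.
- move=> k k'; rewrite xpair_eqE eq_sym.
  by have /andP[/negPf-> _] := KP k'.
Qed.

(** The counting hypothesis says that [get t] is uniform when [t] is; [t0] makes [T] nonempty, so
    that one can divide by its size. *)
Lemma uniform_prob_digraph_lens (T : finType) (t0 : T)
    (get : T -> {set 'I_n * 'I_n}) (A : {set T}) (P : T -> Prop) :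
    (forall Q : pred {set 'I_n * 'I_n},
      (#|[set t | Q (get t)]| * #|{set 'I_n * 'I_n}| =
       #|T| * #|[set X | Q X]|)%N) ->
    (forall t, two_step (get t) -> t \in A) ->
    (forall t, confluent (get t) -> P t) ->
  1 - 400 * alpha ^+ n <= uniform_prob R A P.
Proof.
move=> cardE twoA confP; rewrite /uniform_prob.
(* In the first case the bound is trivial. In the second, fewer than half of all [t] fail
   [two_step], hence [A] holds more than half of [T]. *)
have [big|small] := leP 1 (400 * alpha ^+ n).
  by apply: le_trans (_ : 0 <= _); [lra | rewrite divr_ge0].
have G0 : 0 < #|{set 'I_n * 'I_n}|%:R :> R.
  by rewrite ltr0n; apply/card_gt0P; exists set0.
have T0 : 0 < #|T|%:R :> R by rewrite ltr0n; apply/card_gt0P; exists t0.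
have pull (Q : pred {set 'I_n * 'I_n}) (c : R) :
    #|[set X | Q X]|%:R <= c * #|{set 'I_n * 'I_n}|%:R ->
    #|[set t | Q (get t)]|%:R <= c * #|T|%:R.
  move=> le_c; rewrite -(ler_pM2r G0) -natrM cardE natrM mulrAC [leRHS]mulrC.
  by rewrite ler_pM2l.
have bad1 := pull (fun X => ~~ confluent X) _ card_not_confluent.
have bad2 := pull (fun X => ~~ two_step X) _ card_not_two_step.
move: bad1 bad2; set b1 := [set t | _]; set b2 := [set t | _] => bad1 bad2.
set B := [set t in A | _].
have leT : #|T|%:R <= #|A|%:R + #|b2|%:R :> R.
  rewrite -natrD ler_nat -cardsT; apply: leq_trans (leq_card_setU _ _).
  apply/subset_leq_card/subsetP => t _; rewrite !inE.
  by case: (boolP (two_step _)) => [/twoA->|]; rewrite ?orbT.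
have leA : #|A|%:R <= #|B|%:R + #|b1|%:R :> R.
  rewrite -natrD ler_nat; apply: leq_trans (leq_card_setU _ _).
  apply/subset_leq_card/subsetP => t tA; rewrite !inE tA /=.
  by case: (boolP (confluent _)) => [/confP/asboolP->|]; rewrite ?orbT.
have A0 : 0 < #|A|%:R :> R by nra.
have e0 : 0 <= alpha ^+ n by rewrite exprn_ge0 // /alpha; lra.
rewrite ler_pdivlMr //.
move: leT leA A0 e0 bad1 bad2 T0 small.
set e := alpha ^+ n; set a := #|A|%:R; set b := #|B|%:R; set t := #|T|%:R.
move=> leT leA A0 e0 bad1 bad2 T0 small.
(* Passing from [T] to [A] turns the bound [100 * e * t] on non-confluent elements into
   [200 * e * a], within the allowed [400 * e * a]. *)
have ta : t <= 2 * a by nra.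
have : e * t <= e * (2 * a) by apply: ler_wpM2l.
nra.
Qed.

End RandomDigraphs.

(** * Transfer to the two kinds of topologies *)

Lemma mem_delta1 n m (step : 'I_n -> 'I_m -> 'I_n -> bool) i x k :
  step i x k -> k \in delta step i [:: x].
Proof.
by move=> ixk; rewrite inE; apply/existsP; exists [tuple k]; rewrite /= ixk eqxx.
Qed.

(** The symbol [x] may depend on the target [k] but not on the source, so a single one-letter word
    takes both states to [k]. *)
Lemma confluent_path_mergeable n m (step : 'I_n -> 'I_m -> 'I_n -> bool)
    (X : {set 'I_n * 'I_n}) :
    (forall k, exists x, forall i, (i, k) \in X -> step i x k) ->
  confluent X -> path_mergeable step.
Proof.
move=> HX /forallP cX i j ij.
have /implyP/(_ ij)/existsP[k /andP[ik jk]] := cX (i, j).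
have [x Hx] := HX k.
by exists [:: x], k; rewrite in_setI !mem_delta1 ?Hx.
Qed.

Lemma uniform_prob_edge (R : realType) n m : (0 < m)%N ->
  1 - 400 * (363 / 400) ^+ n <=
    uniform_prob R (irreducible_edge_topologies n m)
      (fun E => path_mergeable (edge_step E)).
Proof.
case: m => // m _.
(* The fixed symbol is [ord0], available since there is at least one symbol. *)
pose slice (E : edge_topology n m.+1) : {set 'I_n * 'I_n} :=
  (fun p => (p, ord0)) @^-1: E.
apply: (@uniform_prob_digraph_lens _ _ _ set0 slice).
- by move=> Q; apply: card_preimset_lens => p q [].
- move=> E; rewrite inE; apply: two_step_irreducible => i j.
  by rewrite inE => ijE; apply/existsP; exists ord0.
- move=> E; apply: confluent_path_mergeable => k; exists ord0 => i.
  by rewrite inE.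
Qed.

Lemma uniform_prob_state (R : realType) n m : (0 < m)%N ->
  1 - 400 * (363 / 400) ^+ n <=
    uniform_prob R (irreducible_state_topologies n m)
      (fun T => path_mergeable (state_step T)).
Proof.
case: m => // m _.
pose O : {ffun 'I_n -> {set 'I_m.+1}} := [ffun=> setT].
have full : [forall j, (set0 : {set 'I_n * 'I_n}, O).2 j != set0].
  by apply/forallP=> j; rewrite ffunE; apply/set0Pn; exists ord0.
pose t0 : state_topology n m.+1 := exist _ (set0, O) full.
(* Replacing the graph leaves the output sets alone, so the proof of their nonemptiness carries
   over. *)
pose put (X : {set 'I_n * 'I_n}) (T : state_topology n m.+1) :
  state_topology n m.+1 := exist _ (X, (val T).2) (valP T).
apply: (@uniform_prob_digraph_lens _ _ _ t0 (fun T => (val T).1)).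
- move=> Q; apply: (card_lens (put := put)) => // X T.
  by apply: val_inj => /=; rewrite -surjective_pairing.
- by move=> T; rewrite inE; apply: two_step_irreducible.
- move=> T; apply: confluent_path_mergeable => k.
  have /forallP/(_ k)/set0Pn[x xk] := valP T.
  by exists x => i ik; rewrite /state_step /state_graph ik.
Qed.

Theorem proposition2 (R : realType) :
  (exists alpha C : R,
    [/\ 0 < alpha, alpha < 1, 0 < C &
      forall n m : nat, (0 < n)%N -> (0 < m)%N ->
        1 - C * alpha ^+ n <=
          uniform_prob R (irreducible_edge_topologies n m)
            (fun E => path_mergeable (edge_step E))])
  /\
  (exists alpha C : R,
    [/\ 0 < alpha, alpha < 1, 0 < C &
      forall n m : nat, (0 < n)%N -> (0 < m)%N ->
        1 - C * alpha ^+ n <=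
          uniform_prob R (irreducible_state_topologies n m)
            (fun T => path_mergeable (state_step T))]).
Proof.
split; exists (363 / 400), 400; split; try lra => n m _ m0.
  by move=> n m _; apply: uniform_prob_edge.
by move=> n m _; apply: uniform_prob_state.
Qed.
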